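(* Consider a sequence (indexed by $n\to\infty$) of attributed Erdős–Rényi pairs $\mathcal{G}(n,\bm p;m,\bm q)$, where $m$, $\bm p$, $\bm q$ may depend on $n$. Let $\psi_{\mathrm a}=(\sqrt{q_{11}q_{00}}-\sqrt{q_{10}q_{01}})^2$. If $$p_{11}=O\!\left(\tfrac{\log n}{n}\right),\qquad p_{10}+p_{01}=O\!\left(\tfrac1{\log n}\right),\qquad \frac{p_{10}p_{01}}{p_{11}p_{00}}=O\!\left(\tfrac1{(\log n)^3}\right),$$ and $$np_{11}+m\psi_{\mathrm a}-\log n\to+\infty,$$ then the MAP estimator achieves exact alignment with high probability, i.e. $\lim_{n\to\infty}\mathsf P(\hat\pi_{\mathrm{MAP}}(G_1,G_2')\ne\Pi^* )=0$.
   Context: Attributed Erdős–Rényi pair $\mathcal{G}(n,\bm p;m,\bm q)$: two random graphs $G_1,G_2$ on a common vertex set consisting of $n$ user vertices $\mathcal V_{\mathrm u}=[n]$ and $m$ attribute vertices $\mathcal V_{\mathrm a}$ (disjoint from $\mathcal V_{\mathrm u}$). Let $\mathcal E_{\mathrm u}$ be the set of (unordered) pairs of distinct users and $\mathcal E_{\mathrm a}=\mathcal V_{\mathrm u}\times\mathcal V_{\mathrm a}$; there are no edges between attribute vertices. $G_k(e)\in\{0,1\}$ indicates whether $e$ is an edge of $G_k$. Independently over $e\in\mathcal E_{\mathrm u}\cup\mathcal E_{\mathrm a}$, $\mathsf P((G_1(e),G_2(e))=(a,b))=p_{ab}$ for $e\in\mathcal E_{\mathrm u}$ and $=q_{ab}$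 for $e\in\mathcal E_{\mathrm a}$ ($a,b\in\{0,1\}$), where $\bm p=(p_{11},p_{10},p_{01},p_{00})$ and $\bm q=(q_{11},q_{10},q_{01},q_{00})$ are probability vectors. Standing assumption: $G_1(e)$ and $G_2(e)$ are positively correlated for every $e$ (correlation coefficient defined and $>0$). Anonymization: $\Pi^*$ is uniform on the set $\mathcal S_n$ of permutations of $[n]$, independent of $(G_1,G_2)$, and $G_2'$ is obtained from $G_2$ by relabeling each user $i$ as $\Pi^*(i)$ (attribute vertices keep their labels). An estimator is a function $\hat\pi(G_1,G_2')\in\mathcal S_n$. The MAP estimator $\hat\pi_{\mathrm{MAP}}(G_1,G_2')$ is a maximizer over $\pi\in\mathcal S_n$ of the posterior $\mathsf P(\Pi^*=\pi\mid G_1,G_2')$. $f(n)=O(g(n))$ means $\limsup_{n\to\infty}|f(n)|/g(n)<\infty$. *)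

(* Defs.v *)
From mathcomp Require Import all_boot all_order all_algebra all_fingroup.
From mathcomp Require Import all_classical all_reals all_analysis.

Set Implicit Arguments.
Unset Strict Implicit.
Unset Printing Implicit Defensive.

Import Order.TTheory GRing.Theory Num.Theory.
Import numFieldNormedType.Exports.

Local Open Scope ring_scope.

Section Graphs.
Variables n m : nat.

Definition user_edge := {e : {set 'I_n} | #|e| == 2%N}.

Definition attr_edge : Type := 'I_n * 'I_m.

Definition edge : Type := user_edge + attr_edge.

Definition graph : Type := {ffun edge -> bool}.

Lemma card_perm_user_edge (s : 'S_n) (e : user_edge) : #|s @: val e| == 2%N.
Proof. by rewrite card_imset; [exact: (valP e)|exact: perm_inj]. Qed.

Definition perm_edge (s : 'S_n) (e : edge) : edge :=
  match e with
  | inl u => inl (Sub (s @: val u) (card_perm_user_edge s u))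
  | inr (i, a) => inr (s i, a)
  end.

(* [e] is an edge of [relabel s g] iff its preimage under [s] is an edge of
   [g]. *)
Definition relabel (s : 'S_n) (g : graph) : graph :=
  [ffun e => g (perm_edge s^-1%g e)].

(* A triple (G1, G2, Pi), with Pi the hidden permutation. *)
Definition outcome : Type := graph * graph * 'S_n.

Definition G1 (w : outcome) : graph := w.1.1.
Definition G2 (w : outcome) : graph := w.1.2.
Definition Pi (w : outcome) : 'S_n := w.2.
Definition G2' (w : outcome) : graph := relabel (Pi w) (G2 w).

End Graphs.

Section PairLaws.
Variable R : realType.

(* [r a b] is the probability of the pair of edge indicators (a, b); thus
   [r true false] is r_10. *)
Definition pair_law := bool -> bool -> R.

Definition prob_vector (r : pair_law) : Prop :=
  (forall a b, 0 <= r a b) /\ \sum_(a : bool) \sum_(b : bool) r a b = 1.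

Definition pair_expect (r : pair_law) (X : bool -> bool -> R) : R :=
  \sum_(a : bool) \sum_(b : bool) r a b * X a b.

Definition pair_cov (r : pair_law) (X Y : bool -> bool -> R) : R :=
  pair_expect r (fun a b => X a b * Y a b) - pair_expect r X * pair_expect r Y.

Definition coord1 : bool -> bool -> R := fun a _ => a%:R.
Definition coord2 : bool -> bool -> R := fun _ b => b%:R.

Definition correlation (r : pair_law) : R :=
  pair_cov r coord1 coord2 /
    Num.sqrt (pair_cov r coord1 coord1 * pair_cov r coord2 coord2).

(* The coefficient is defined when both variances are nonzero. *)
Definition positively_correlated (r : pair_law) : Prop :=
  [/\ 0 < pair_cov r coord1 coord1,
      0 < pair_cov r coord2 coord2
    & 0 < correlation r].

Definition psi (r : pair_law) : R :=
  (Num.sqrt (r true true * r false false)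
   - Num.sqrt (r true false * r false true)) ^+ 2.

End PairLaws.

Section Alignment.
Variables (R : realType) (n m : nat) (p q : pair_law R).

Definition edge_law (e : edge n m) : pair_law R :=
  match e with inl _ => p | inr _ => q end.

Definition mass (w : outcome n m) : R :=
  (\prod_(e : edge n m) edge_law e (G1 w e) (G2 w e)) * #|'S_n|%:R^-1.

Definition Pr (A : pred (outcome n m)) : R := \sum_(w | A w) mass w.

(* P(Pi = s | G1 = g1, G2' = g2); if the conditioning event is null, the value
   is 0 since x / 0 = 0. *)
Definition posterior (s : 'S_n) (g1 g2 : graph n m) : R :=
  Pr (fun w => [&& Pi w == s, G1 w == g1 & G2' w == g2]) /
  Pr (fun w => (G1 w == g1) && (G2' w == g2)).

Definition estimator := graph n m -> graph n m -> 'S_n.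

(* No tie-breaking rule is imposed, and on null observations every value is
   allowed. *)
Definition is_MAP (est : estimator) : Prop :=
  forall g1 g2 s, posterior s g1 g2 <= posterior (est g1 g2) g1 g2.

Definition error_prob (est : estimator) : R :=
  Pr (fun w => est (G1 w) (G2' w) != Pi w).

End Alignment.

(* Main.v *)
Require Import Defs.
From mathcomp Require Import all_boot all_order all_algebra all_fingroup.
From mathcomp Require Import all_classical all_reals all_analysis.
From mathcomp Require Import ring lra zify.

(** By the union bound, a MAP error requires some [s != 1] whose likelihood is
    at least that of the truth. Let [k] be the number of users moved by [s].
    Bounding the indicator of this event by the square root of the likelihood
    ratio, its probability becomes a sum over edge labellings of a product of
    2x2 kernels chained along the cycles of [s] acting on edges, hence at most
    the product of the Frobenius norms of the kernels of the moved edges. The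
    square of such a norm is [1 - 2 psi], which gives
    [exp (- k (n - k) psi_u - k m psi_a)]; this suffices against the [n ^ k]
    permutations as long as [k p11 <= 32], since then
    [(n - k) psi_u = n p11 - O(1)].
    For larger [k] the probability that the intersection graph is much too
    sparse has to be separated out: except on an event of probability at most
    [exp (- n)] (union bound over the [2 ^ n] sets of users), at least
    [k n p11 / 16] edges of the intersection graph meet the moved users.
    Weighting each of those by a large constant [z] keeps the Frobenius norm at
    most 1 in the sparse regime, while [z ^ (- k n p11 / 16)] is gained. *)

Set Implicit Arguments.
Unset Strict Implicit.
Unset Printing Implicit Defensive.

Import Order.TTheory GRing.Theory Num.Theory.
Import numFieldNormedType.Exports.

Local Open Scope ring_scope.

(** * Kernels chained along a permutation *)

Section Kernels.
Variables (R : realType) (A : finType).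
Implicit Types K L : A -> A -> R.

Definition kernel_trace K : R := \sum_a K a a.
(** The Frobenius norm. *)
Definition kernel_norm K : R := Num.sqrt (\sum_a \sum_b K a b ^+ 2).
Definition kernel_comp K L : A -> A -> R := fun a b => \sum_c K a c * L c b.

(** By Lagrange's identity, the double sum of [(f i * g j - f j * g i) ^+ 2] is twice the difference
    of the two sides. *)
Lemma cauchy_schwarz_sum (I : finType) (f g : I -> R) :
  (\sum_i f i * g i) ^+ 2 <= (\sum_i f i ^+ 2) * (\sum_i g i ^+ 2).
Proof.
suff : 0 <= \sum_i \sum_j (f i * g j - f j * g i) ^+ 2.
  under eq_bigr => i _.
    rewrite (eq_bigr (fun j => (f i ^+ 2 * g j ^+ 2 + g i ^+ 2 * f j ^+ 2)
      - 2%:R * (f i * g i) * (f j * g j))); last by move=> j _; ring.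
    rewrite sumrB big_split /= -!mulr_sumr.
  over.
  rewrite sumrB big_split /= -!mulr_suml -mulr_sumr.
  move: (\sum_i f i ^+ 2) (\sum_i g i ^+ 2) (\sum_i f i * g i) => x y s; nra.
by apply: sumr_ge0 => i _; apply: sumr_ge0 => j _; exact: sqr_ge0.
Qed.

Lemma kernel_norm_ge0 K : 0 <= kernel_norm K. Proof. exact: sqrtr_ge0. Qed.

Lemma sqr_kernel_norm K : kernel_norm K ^+ 2 = \sum_a \sum_b K a b ^+ 2.
Proof.
by rewrite sqr_sqrtr//; apply: sumr_ge0 => i _; apply: sumr_ge0 => j _;
  exact: sqr_ge0.
Qed.

Lemma kernel_trace_comp K L :
  kernel_trace (kernel_comp K L) <= kernel_norm K * kernel_norm L.
Proof.
apply: le_trans (ler_norm _) _.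
rewrite -ler_sqr ?nnegrE ?mulr_ge0 ?kernel_norm_ge0// exprMn !sqr_kernel_norm.
rewrite real_normK ?num_real// /kernel_trace /kernel_comp.
rewrite [X in _ * X]exchange_big /= !pair_big /=.
exact: (cauchy_schwarz_sum (fun i : A * A => K i.1 i.2) (fun i => L i.2 i.1)).
Qed.

Lemma kernel_norm_comp K L :
  kernel_norm (kernel_comp K L) <= kernel_norm K * kernel_norm L.
Proof.
rewrite -ler_sqr ?nnegrE ?mulr_ge0 ?kernel_norm_ge0// exprMn !sqr_kernel_norm.
rewrite [X in _ * X]exchange_big /= mulr_suml; apply: ler_sum => a _.
rewrite mulr_sumr; apply: ler_sum => b _.
exact: (cauchy_schwarz_sum (fun c => K a c) (fun c => L c b)).
Qed.

Section PermBound.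
Variable T : finType.
Implicit Types (s : {perm T}) (M : T -> A -> A -> R).

(** A fixed point only sees the diagonal of its kernel. A moved point lies on a cycle of length at
    least two, where the trace of the composed kernels is at most the product of their norms. *)
Definition perm_weight s M (x : T) : R :=
  if s x == x then kernel_trace (M x) else kernel_norm (M x).

Definition ffun_set (b : {ffun T -> A}) (e : T) (c : A) : {ffun T -> A} :=
  [ffun x => if x == e then c else b x].

(** The labellings with the reference value [a0] at [e] represent the classes of labellings that
    agree away from [e]. *)
Lemma sum_ffun_set (a0 : A) (e : T) (F : {ffun T -> A} -> R) :
  \sum_b F b = \sum_(b : {ffun T -> A} | b e == a0) \sum_c F (ffun_set b e c).
Proof.
rewrite (partition_big (fun b => ffun_set b e a0)
  (fun b : {ffun T -> A} => b e == a0)) /=; last first.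
  by move=> b _; rewrite ffunE eqxx.
apply: eq_bigr => b /eqP be.
rewrite (reindex_onto (fun c => ffun_set b e c) (fun b' : {ffun T -> A} => b' e)) /=.
  apply: eq_bigl => c; rewrite [ffun_set b e c e]ffunE !eqxx andbT.
  by apply/eqP/ffunP => x; rewrite !ffunE; case: eqP => [->|].
move=> b' /eqP/ffunP b'b; apply/ffunP => x; have := b'b x; rewrite !ffunE.
by case: eqP => // ->.
Qed.

Section Step.
Variables (a0 : A) (s : {perm T}) (M : T -> A -> A -> R) (e : T).
Hypothesis se : s e != e.
Let f := (s^-1)%g e.
(** [s'] cuts [e] out of its cycle and sends [f] straight to [s e]. The indicator kernel at [e] in
    [M'] pins the idle variable to [a0], so that each class of labellings is counted once. *)
Let s' := (s * tperm e (s e))%g.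
Let M' x := if x == e then fun a b => ((a == a0) && (b == a0))%:R
            else if x == f then kernel_comp (M f) (M e) else M x.

Lemma contract_fe : f != e.
Proof. by apply: contra se => /eqP fe; rewrite -[X in s X]fe permKV. Qed.

Lemma contract_permE x : s' x = if x == e then e else if x == f then s e else s x.
Proof.
rewrite permM; case: (eqVneq x e) => [->|xe]; first exact: tpermR.
case: (eqVneq x f) => [->|xf]; first by rewrite permKV tpermL.
by rewrite tpermD//; [apply: contra xf; rewrite /f => /eqP ->; rewrite permK
  | rewrite (inj_eq perm_inj) eq_sym].
Qed.

Lemma contract_sum :
  \sum_(b : {ffun T -> A}) \prod_x M x (b x) (b (s x)) =
  \sum_(b : {ffun T -> A}) \prod_x M' x (b x) (b (s' x)).
Proof.
have fe := contract_fe.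
rewrite (sum_ffun_set a0 e) [RHS](bigID (fun b : {ffun T -> A} => b e == a0)) /=.
rewrite [X in _ = _ + X]big1 ?addr0; last first.
  by move=> b be; rewrite (bigD1 e) //= /M' eqxx (negPf be) /= mul0r.
apply: eq_bigr => b be.
rewrite [RHS](bigD1 e)//= (bigD1 f)//= /M' !eqxx (negPf fe) contract_permE eqxx be /=.
rewrite mul1r contract_permE (negPf fe) eqxx mulr_suml; apply: eq_bigr => c _.
rewrite (bigD1 e)//= (bigD1 f)//= !ffunE !eqxx (negPf se) (negPf fe) permKV eqxx.
rewrite mulrA [M e _ _ * _]mulrC; congr (_ * _).
apply: eq_bigr => x /andP[xe xf]; rewrite !ffunE (negPf xe) (negPf xf) contract_permE.
by rewrite (negPf xe) (negPf xf) ifN//; apply: contra xf; rewrite /f => /eqP <-; rewrite permK.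
Qed.

Lemma contract_weight : (forall x a b, 0 <= M x a b) ->
  \prod_x perm_weight s' M' x <= \prod_x perm_weight s M x.
Proof.
move=> M0; have fe := contract_fe.
have w0 x : 0 <= perm_weight s M x.
  by rewrite /perm_weight; case: ifP => _; [exact: sumr_ge0|exact: kernel_norm_ge0].
rewrite (bigD1 e)//= (bigD1 f)//= [leRHS](bigD1 e)//= [X in _ <= _ * X](bigD1 f)//=.
rewrite {1}/perm_weight contract_permE !eqxx /M' eqxx.
have -> : kernel_trace (fun a b => ((a == a0) && (b == a0))%:R) = 1.
  rewrite /kernel_trace (bigD1 a0)//= eqxx big1 ?addr0// => i /negPf ->.
  by rewrite andbF.
rewrite mul1r mulrA; apply: ler_pM.
- rewrite /perm_weight; case: ifP => _; last exact: kernel_norm_ge0.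
  rewrite (negPf fe) eqxx; apply: sumr_ge0 => a _; apply: sumr_ge0 => c _.
  exact: mulr_ge0.
- apply: prodr_ge0 => x /andP[xe xf].
  by rewrite /perm_weight (negPf xe) (negPf xf); case: ifP => _;
    [exact: sumr_ge0|exact: kernel_norm_ge0].
- rewrite /perm_weight (negPf fe) eqxx (negPf se) permKV [e == f]eq_sym (negPf fe).
  rewrite mulrC.
  (* On a 2-cycle [s e] is [f], which becomes fixed and contributes a trace; on a longer cycle [f]
     stays moved. *)
  by case: ifP => _; [exact: kernel_trace_comp|exact: kernel_norm_comp].
- apply: ler_prod => x /andP[xe xf]; rewrite /perm_weight.
  rewrite contract_permE (negPf xe) (negPf xf) lexx andbT.
  exact: w0.
Qed.

End Step.

(* Summing out the variable at a moved point [e] replaces the two kernels that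
   meet there by their composition; the variable stays as a fixed point whose
   kernel has trace 1. *)
Lemma sum_perm_kernels s M : (forall x a b, 0 <= M x a b) ->
  \sum_(b : {ffun T -> A}) \prod_x M x (b x) (b (s x)) <=
  \prod_x perm_weight s M x.
Proof.
have [N] := ubnP #|[set x | s x != x]|; elim: N s M => // N IH s M sN M0.
case: (pickP [pred x | s x != x]) => [e /= se|s1]; last first.
  rewrite le_eqVlt; apply/orP; left; apply/eqP; symmetry.
  rewrite (eq_bigr (fun x => \sum_a M x a a)) => [|x _]; last first.
    by rewrite /perm_weight; have /= /negbFE -> := s1 x.
  rewrite bigA_distr_bigA; apply: eq_bigr => b _; apply: eq_bigr => x _.
  by have /= /negbFE/eqP -> := s1 x.
(* The contraction needs a reference label. With [A] empty and [e] in [T] there is no labelling to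
   sum over. *)
case: (pickP (@predT A)) => [a0 _|A0]; last first.
  rewrite big1 => [|b _]; first by apply: prodr_ge0 => x _; rewrite /perm_weight;
    case: ifP => _; [exact: sumr_ge0|exact: kernel_norm_ge0].
  by have := A0 (b e).
rewrite (contract_sum a0 _ se); apply: le_trans (contract_weight a0 se M0).
apply: IH => [|x a b]; last first.
  case: ifP => _; first exact: ler0n.
  by case: ifP => // _; apply: sumr_ge0 => c _; exact: mulr_ge0.
rewrite -ltnS; apply: leq_trans sN; rewrite ltnS; apply: proper_card.
apply/properP; split.
  apply/fintype.subsetP => x; rewrite !inE contract_permE//.
  case: (eqVneq x e) => [->|xe]; first by rewrite eqxx.
  case: (eqVneq x (s^-1 e)%g) => [-> _|//]; rewrite permKV eq_sym.
  exact: contract_fe.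
by exists e; rewrite !inE// contract_permE// eqxx negbK.
Qed.

End PermBound.
End Kernels.

(** * Kernels of a pair law *)

Section PairKernels.
Variable R : realType.
Implicit Types (r : pair_law R) (z : R).

Definition tilt z (a b : bool) : R := if a && b then z else 1.

(** The indicator [a] of an edge in [G1] is summed out; [b] and [b'] are the indicators of [G2] at
    the edge and at its image. At [z = 1] this is the edge's factor in the geometric mean of two
    likelihoods. *)
Definition tilted_kernel z r : bool -> bool -> R := fun b b' =>
  \sum_(a : bool) tilt z a b * (Num.sqrt (r a b) * Num.sqrt (r a b')).

Lemma tilt_ge0 z a b : 0 <= z -> 0 <= tilt z a b.
Proof. by rewrite /tilt; case: ifP. Qed.

Lemma tilted_kernel_ge0 z r b b' : 0 <= z -> 0 <= tilted_kernel z r b b'.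
Proof.
by move=> z0; apply: sumr_ge0 => a _; rewrite mulr_ge0 ?tilt_ge0 ?mulr_ge0 ?sqrtr_ge0.
Qed.

Lemma prob_vectorE r : prob_vector r ->
  [/\ 0 <= r true true, 0 <= r true false, 0 <= r false true, 0 <= r false false
   & r true true + r true false + r false true + r false false = 1].
Proof. by move=> [r0]; rewrite !big_bool /= !addrA => r1; split. Qed.

Lemma tilted_trace z r : prob_vector r ->
  kernel_trace (tilted_kernel z r) = 1 + (z - 1) * r true true.
Proof.
move=> /prob_vectorE[r11 r10 r01 r00 r1].
rewrite /kernel_trace /tilted_kernel /tilt !big_bool /= -!expr2 !sqr_sqrtr//.
have -> : r false false = 1 - r true true - r true false - r false true by rewrite -r1; ring.
ring.
Qed.

Lemma sqr_tilted_norm z r (s := Num.sqrt (r true true * r false false) *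
    Num.sqrt (r true false * r false true)) : prob_vector r ->
  kernel_norm (tilted_kernel z r) ^+ 2 =
  (1 - r true true) ^+ 2 - 2 * r true false * r false true
  + z ^+ 2 * r true true ^+ 2 + 2 * z * r true true * r false true
  + (z ^+ 2 + 1) * r true true * r true false + 2 * (z + 1) * s.
Proof.
move=> /prob_vectorE[r11 r10 r01 r00 r1].
rewrite sqr_kernel_norm /s /tilted_kernel /tilt !big_bool /= !sqrtrM//.
have -> : 1 - r true true = r true false + r false true + r false false.
  by rewrite -r1; ring.
rewrite -[r true true in RHS]sqr_sqrtr// -[r true false in RHS]sqr_sqrtr//.
rewrite -[r false true in RHS]sqr_sqrtr// -[r false false in RHS]sqr_sqrtr//.
by rewrite !(sqrtr_sqr, ger0_norm) ?sqrtr_ge0//; ring.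
Qed.

Lemma sqr_kernel_norm1 r : prob_vector r ->
  kernel_norm (tilted_kernel 1 r) ^+ 2 = 1 - 2 * psi r.
Proof.
move=> r_prob; rewrite sqr_tilted_norm// /psi [in RHS]sqrrB.
have /prob_vectorE[r11 r10 r01 r00 r1] := r_prob.
rewrite !sqr_sqrtr ?mulr_ge0//.
have -> : r false false = 1 - r true true - r true false - r false true by rewrite -r1; ring.
ring.
Qed.

Lemma kernel_norm1_le r : prob_vector r ->
  kernel_norm (tilted_kernel 1 r) <= expR (- psi r).
Proof.
move=> r_prob; rewrite -ler_sqr ?nnegrE ?kernel_norm_ge0 ?expR_ge0//.
rewrite sqr_kernel_norm1// -expRM_natl.
by have := expR_ge1Dx (2 * - psi r); lra.
Qed.

(** Since [s <= d * r true true], every positive term of the squared norm other than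
    [(1 - r true true) ^+ 2] carries a factor [r true true]. The linear term [- 2 * r true true] of
    that square pays for all of them. *)
Lemma tilted_norm_le1 z d r : prob_vector r -> 0 <= z ->
  Num.sqrt (r true false * r false true)
    <= d * Num.sqrt (r true true * r false false) ->
  (z ^+ 2 + 1) * (r true true + r true false) + 2 * z * r false true
    + 2 * (z + 1) * d <= 2 ->
  0 <= d ->
  kernel_norm (tilted_kernel z r) <= 1.
Proof.
move=> r_prob z0 dP zP d0; rewrite -ler_sqr ?nnegrE ?kernel_norm_ge0// expr1n.
rewrite sqr_tilted_norm//.
have /prob_vectorE[r11 r10 r01 r00 r1] := r_prob.
set s := _ * Num.sqrt _.
have sP : s <= d * r true true.
  apply: (@le_trans _ _ (d * (r true true * r false false))).
    rewrite -[leRHS](_ : Num.sqrt (r true true * r false false) *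
      (d * Num.sqrt (r true true * r false false)) = _).
      by rewrite /s ler_wpM2l// sqrtr_ge0.
    by rewrite mulrCA -expr2 sqr_sqrtr// mulr_ge0.
  rewrite ler_wpM2l// ler_piMr//; lra.
have : 2 * (z + 1) * s <= 2 * (z + 1) * (d * r true true).
  by rewrite ler_wpM2l// mulr_ge0// addr_ge0.
have := ler_wpM2r r11 zP.
have : 0 <= r true false * r false true by exact: mulr_ge0.
move: s (r true true) (r true false) (r false true) sP => s x y w _.
nra.
Qed.

End PairKernels.

(** * Permutations of edges *)

Section EdgePermutation.
Variables n m : nat.
Implicit Types (s t : 'S_n) (u : user_edge n) (S : {set 'I_n}).

Lemma perm_edgeM s t (e : edge n m) :
  perm_edge (s * t)%g e = perm_edge t (perm_edge s e).
Proof.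
case: e => [u|[i a]] /=; last by rewrite permM.
congr inl; apply: val_inj; rewrite !SubK.
by rewrite -imset_comp; apply: eq_imset => i; rewrite permM.
Qed.

Lemma perm_edge1 (e : edge n m) : perm_edge 1%g e = e.
Proof.
case: e => [u|[i a]] /=; last by rewrite perm1.
congr inl; apply: val_inj; rewrite SubK.
by rewrite -[RHS]imset_id; apply: eq_imset => i; rewrite perm1.
Qed.

Lemma perm_edge_inj s : injective (@perm_edge n m s).
Proof.
by apply: (@can_inj _ _ _ (perm_edge s^-1%g)) => e; rewrite -perm_edgeM mulgV perm_edge1.
Qed.

Definition edge_perm s : {perm edge n m} := perm (@perm_edge_inj s).

Lemma relabelM s t (g : graph n m) : relabel t (relabel s g) = relabel (s * t)%g g.
Proof. by apply/ffunP => e; rewrite !ffunE invMg perm_edgeM. Qed.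

Lemma relabel1 (g : graph n m) : relabel 1%g g = g.
Proof. by apply/ffunP => e; rewrite ffunE invg1 perm_edge1. Qed.

Definition moved s : {set 'I_n} := [set i | s i != i].

Definition meets S u := [exists i in S, i \in val u].

Lemma in_moved s i : (i \in moved s) = (s i != i).
Proof. by rewrite inE. Qed.

Lemma user_edge_doubleton (i j : 'I_n) : i != j -> #|[set i; j]| == 2%N.
Proof. by move=> ij; rewrite cards2 ij. Qed.

Lemma meets_moved s u : perm_edge s (inl u : edge n m) != inl u ->
  meets (moved s) u.
Proof.
apply: contraR => /exists_inPn u_fix; apply/eqP; congr inl; apply: val_inj.
rewrite SubK -[RHS]imset_id; apply: eq_in_imset => i iu.
by apply/eqP; apply: contraTT iu; rewrite -in_moved; exact: u_fix.
Qed.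

(* An edge between a moved and an unmoved user is never fixed. *)
Lemma card_moved_user_edges s :
  (#|moved s| * (n - #|moved s|) <=
   #|[set u | perm_edge s (inl u : edge n m) != inl u]|)%N.
Proof.
set S := moved s; have -> : (n - #|S| = #|~: S|)%N by rewrite [RHS]cardsCs finset.setCK card_ord.
rewrite -cardsX.
have nb (x : 'I_n * 'I_n) : x \in finset.setX S (~: S) -> #|[set x.1; x.2]| == 2%N.
  rewrite !inE => /andP[x1 x2]; apply: user_edge_doubleton.
  by apply: contra x1 => /eqP ->; rewrite negbK in x2.
have [->|[x0 x0S]] := set_0Vmem (finset.setX S (~: S)); first by rewrite cards0.
(* A default value for [insubd], never taken on the product set; it is the reason why the empty
   product is treated apart. *)
pose u0 : user_edge n := exist _ [set x0.1; x0.2] (nb _ x0S).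
pose h (x : 'I_n * 'I_n) : user_edge n := insubd u0 [set x.1; x.2].
have hE x : x \in finset.setX S (~: S) -> val (h x) = [set x.1; x.2].
  by move=> xS; rewrite val_insubd nb.
rewrite -(card_in_imset (f := h)); last first.
  (* Injectivity: the two ends are told apart because one is moved and the other is not. *)
  move=> x y xS yS /(congr1 val); rewrite !hE//.
  move: x y xS yS => [i j] [i' j']; rewrite !inE /= !negbK => /andP[si sj] /andP[si' sj'] /setP E.
  have /esym := E i; have /esym := E j; rewrite !inE !eqxx orbT /=.
  case/orP => /eqP ej; first by rewrite -ej sj in si'.
  case/orP => /eqP ei; last by rewrite ei sj' in si.
  by rewrite ei ej.
apply/subset_leq_card/fintype.subsetP => u /imsetP[x xS ->]; rewrite inE.
(* If [{i, j}] were fixed with [i] moved and [j] not, then [s i] would have to be [j = s j], forcing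
   [i = j]. *)
have /= hx := hE _ xS; apply/negP => /eqP [] /(congr1 val) /=; rewrite hx.
move: x xS {hx} => [i j]; rewrite !inE /= negbK => /andP[si /eqP sj] /setP /(_ (s i)).
rewrite imset_f ?inE ?eqxx// (negPf si) /= -{1}sj (inj_eq perm_inj) => /esym/eqP ij.
by rewrite ij sj eqxx in si.
Qed.

(* A fixed edge meeting the moved users is of the form [{i, s i}]. *)
Lemma card_fixed_user_edges s :
  (#|[set u | meets (moved s) u & perm_edge s (inl u : edge n m) == inl u]|
   <= #|moved s|)%N.
Proof.
pose h i := [set i; s i].
rewrite -(card_imset _ val_inj).
apply: leq_trans (leq_imset_card h (moved s)).
apply/subset_leq_card/fintype.subsetP => _ /imsetP[u + ->].
rewrite inE => /andP[/exists_inP[i iS iu] /eqP[] /(congr1 val)]; rewrite SubK => su.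
apply/imsetP; exists i => //; apply/eqP; rewrite eq_sym eqEcard.
rewrite (eqP (valP u)) /h cards2 eq_sym -in_moved iS andbT.
apply/fintype.subsetP => j; rewrite !inE => /orP[] /eqP -> //.
by rewrite -su imset_f.
Qed.

Lemma card_user_edges_at (i : 'I_n) : (n.-1 <= #|[set u : user_edge n | i \in sval u]|)%N.
Proof.
have -> : n.-1 = #|[set~ i]| by rewrite cardsC1 card_ord.
have [->|[j0 j0i]] := set_0Vmem [set~ i]; first by rewrite cards0.
have nb j : j \in [set~ i] -> #|[set i; j]| == 2%N.
  by rewrite !inE eq_sym; exact: user_edge_doubleton.
pose u0 : user_edge n := exist _ [set i; j0] (nb _ j0i).
pose h j : user_edge n := insubd u0 [set i; j].
have hE j : j \in [set~ i] -> val (h j) = [set i; j] by move=> ji; rewrite val_insubd nb.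
rewrite -(card_in_imset (f := h)); last first.
  move=> j j' ji ji' /(congr1 val); rewrite !hE// => /setP/(_ j).
  by rewrite !inE eqxx orbT in ji *; rewrite (negPf ji) /= => /esym/eqP.
apply/subset_leq_card/fintype.subsetP => u /imsetP[j ji ->].
by rewrite inE hE// !inE eqxx.
Qed.

(** Double counting of incidences: each user of [S] lies on at least [n.-1] edges, and each edge has
    at most two ends in [S]. *)
Lemma card_meets S : (#|S| * n.-1 <= 2 * #|[set u | meets S u]|)%N.
Proof.
apply: (@leq_trans (\sum_(i in S) #|[set u : user_edge n | i \in sval u]|)).
  by rewrite -sum_nat_const; apply: leq_sum => i _; exact: card_user_edges_at.
rewrite (eq_bigr (fun i => \sum_(u : user_edge n | i \in sval u) 1)%N); last first.
  by move=> i _; rewrite sum1dep_card cardsE.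
rewrite (exchange_big_dep (fun u => meets S u)) /=; last first.
  by move=> i u iS iu; apply/exists_inP; exists i.
rewrite mulnC -[#|[set u | _]|]sum1dep_card big_distrl /=.
rewrite [leqRHS]big_mkcond [leqLHS]big_mkcond /=.
apply: leq_sum => u _; case: ifP => // _.
rewrite mul1n sum1dep_card; apply: leq_trans (eq_leq (eqP (valP u))).
apply: subset_leq_card.
by apply/fintype.subsetP => i; rewrite inE => /andP[].
Qed.

Lemma card_moved_attr_edges s :
  #|[set x : 'I_n * 'I_m | s x.1 != x.1]| = (#|moved s| * m)%N.
Proof.
rewrite -[m in RHS]card_ord -cardsT -cardsX; apply: eq_card => x.
by rewrite !inE andbT.
Qed.

End EdgePermutation.

(** * Likelihoods and confusable permutations *)

Section Likelihood.
Variables (R : realType) (n m : nat) (p q : pair_law R).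
Hypotheses (p_prob : prob_vector p) (q_prob : prob_vector q).
Implicit Types (s t : 'S_n) (S : {set 'I_n}) (g : graph n m * graph n m).

Local Notation law := (@edge_law R n m p q).

Lemma law_prob e : prob_vector (law e). Proof. by case: e. Qed.

Lemma law_ge0 e a b : 0 <= law e a b. Proof. by case: (law_prob e). Qed.

Lemma sqrt_prod (I : finType) (F : I -> R) : (forall i, 0 <= F i) ->
  Num.sqrt (\prod_i F i) = \prod_i Num.sqrt (F i).
Proof.
move=> F0; suff [] : 0 <= \prod_i F i /\
    Num.sqrt (\prod_i F i) = \prod_i Num.sqrt (F i) by [].
elim/big_rec2: _ => [|i x y _ [y0 <-]]; first by rewrite sqrtr1.
by rewrite sqrtrM// mulr_ge0.
Qed.

Definition lik g : R := \prod_e law e (g.1 e) (g.2 e).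

Lemma lik_ge0 g : 0 <= lik g.
Proof. by apply: prodr_ge0 => e _; exact: law_ge0. Qed.

Definition relabel2 s g : graph n m * graph n m := (g.1, relabel s g.2).

(** [Pi] and [G2'] together determine [G2], so the event is a single outcome. *)
Lemma joint_prob s (g1 g2 : graph n m) :
  Pr p q (fun w => [&& Pi w == s, G1 w == g1 & G2' w == g2]) =
  lik (g1, relabel s^-1%g g2) / #|'S_n|%:R.
Proof.
rewrite /Pr (big_pred1 ((g1, relabel s^-1%g g2), s)) // => -[[h1 h2] t] /=.
rewrite /Pi /G1 /G2' /G2 /= !xpair_eqE andbC -!andbA; congr (_ && _).
rewrite andbC; case: eqP => [->|]; rewrite ?andbF// !andbT.
by apply/eqP/eqP => [<-|->]; rewrite relabelM ?mulgV ?mulVg relabel1.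
Qed.

Lemma MAP_lik (est : estimator n m) s g : is_MAP p q est ->
  lik g <= lik (relabel2 (s * (est g.1 (relabel s g.2))^-1)%g g).
Proof.
set t := est _ _; move=> est_MAP; have := est_MAP g.1 (relabel s g.2) s.
rewrite /posterior -/t !joint_prob !relabelM mulgV relabel1 -/(relabel2 _ g).
rewrite -surjective_pairing.
set D := Pr _ _ _; set N : R := #|_|%:R.
have N0 : 0 < N by rewrite /N ltr0n; apply/card_gt0P; exists 1%g.
have D_ge : lik g / N <= D.
  have := joint_prob s g.1 (relabel s g.2).
  rewrite relabelM mulgV relabel1 -surjective_pairing => <-.
  rewrite /D /Pr big_mkcond [leRHS]big_mkcond; apply: ler_sum => w _ /=.
  have w0 : 0 <= mass p q w by rewrite mulr_ge0 ?invr_ge0// (lik_ge0 w.1).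
  by case: (Pi w == s) => //=; case: ifP.
have [D0|D0] := ltP 0 D.
  by rewrite ler_pM2r ?invr_gt0// ler_pM2r ?invr_gt0.
(* On a null observation the posteriors carry no information, but then [lik g] vanishes too. *)
move=> _; apply: (@le_trans _ _ 0); last exact: lik_ge0.
by have := le_trans D_ge D0; rewrite pmulr_lle0 ?invr_gt0.
Qed.

(** Because of the inverse, the relabelled graph at [e] reads [g.2] at the image of [e] under [s],
    which is how the kernels are chained. Ties count as confusion. *)
Definition confusable s g := lik g <= lik (relabel2 s^-1%g g).

(** If the estimate [t] differs from the truth [s], then [t * s^-1] is nontrivial and confusable.
    The resulting event does not involve [s], so the average over the hidden permutation
    disappears. *)
Lemma error_prob_le (est : estimator n m) : is_MAP p q est ->
  error_prob p q est <=
  \sum_(g | [exists s, (s != 1%g) && confusable s g]) lik g.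
Proof.
move=> est_MAP; rewrite /error_prob /Pr big_mkcond /=.
rewrite (eq_bigr (fun w : outcome n m => if est w.1.1 (relabel w.2 w.1.2) != w.2
   then lik w.1 / #|'S_n|%:R else 0)) //.
rewrite -(pair_bigA _ (fun g s => if est g.1 (relabel s g.2) != s
   then lik g / #|'S_n|%:R else 0)) /=.
rewrite [leRHS]big_mkcond; apply: ler_sum => g _.
have N0 : 0 < (#|'S_n|%:R : R) by rewrite ltr0n; apply/card_gt0P; exists 1%g.
case: existsP => [_|none]; last first.
  rewrite big1// => s _; case: ifP => // neq; case: none.
  exists (est g.1 (relabel s g.2) * s^-1)%g.
  rewrite /confusable invMg invgK MAP_lik// andbT.
  by apply: contra neq => /eqP/(congr1 (mulg^~ s)); rewrite mulgKV mul1g => ->.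
apply: (@le_trans _ _ (\sum_(s : 'S_n) lik g / #|'S_n|%:R)).
  by apply: ler_sum => s _; case: ifP => // _; rewrite divr_ge0 ?lik_ge0// ltW.
by rewrite sumr_const -cardsE -[lik g / _ *+ _]mulr_natr cardsE divfK ?lt0r_neq0.
Qed.

Lemma sum_graph_pairs (F : edge n m -> bool -> bool -> R) :
  \sum_(g : graph n m * graph n m) \prod_e F e (g.1 e) (g.2 e) = \prod_e \sum_a \sum_b F e a b.
Proof.
rewrite -(pair_bigA _ (fun g1 g2 : graph n m => \prod_e F e (g1 e) (g2 e))) /=.
rewrite [RHS]bigA_distr_bigA; apply: eq_bigr => g1 _.
by rewrite bigA_distr_bigA.
Qed.

Definition edge_tilt S (z : R) (e : edge n m) : R :=
  if e is inl u then if meets S u then z else 1 else 1.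

Lemma edge_tilt_ge0 S z e : 0 <= z -> 0 <= edge_tilt S z e.
Proof. by case: e => // u z0 /=; case: ifP. Qed.

Definition joint_degree S g : nat :=
  #|[set u | [&& meets S u, g.1 (inl u) & g.2 (inl u)]]|.

Lemma prod_tilt S z g :
  \prod_e tilt (edge_tilt S z e) (g.1 e) (g.2 e) = z ^+ joint_degree S g.
Proof.
rewrite big_sumType /= [X in _ * X]big1 ?mulr1; last by move=> x _; rewrite /tilt if_same.
rewrite /joint_degree -prodr_const [RHS]big_mkcond /=; apply: eq_bigr => u _.
by rewrite inE /tilt andbC; case: (_ && _); case: (meets S u).
Qed.

(** For fixed [g2], summing over [g1] edge by edge produces the tilted kernels; what remains is a
    sum over labellings [g2] chained along [edge_perm m s]. *)
Lemma sum_sqrt_lik s S z : 0 <= z ->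
  \sum_(g : graph n m * graph n m)
     z ^+ joint_degree S g * Num.sqrt (lik g * lik (relabel2 s^-1%g g)) <=
  \prod_e perm_weight (edge_perm m s)
            (fun e => tilted_kernel (edge_tilt S z e) (law e)) e.
Proof.
move=> z0; apply: le_trans (sum_perm_kernels _ _); last first.
  by move=> e a b; rewrite tilted_kernel_ge0// edge_tilt_ge0.
rewrite -(pair_bigA _ (fun g1 g2 : graph n m => z ^+ joint_degree S (g1, g2) *
  Num.sqrt (lik (g1, g2) * lik (relabel2 s^-1%g (g1, g2))))) /=.
rewrite exchange_big /= le_eqVlt; apply/orP; left; apply/eqP.
apply: eq_bigr => g2 _; rewrite /tilted_kernel bigA_distr_bigA.
apply: eq_bigr => g1 _; rewrite -prod_tilt sqrtrM ?lik_ge0// big_split /=.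
congr (_ * _); rewrite big_split /lik /= !sqrt_prod//=; last first.
- by move=> e; exact: law_ge0.
- by move=> e; exact: law_ge0.
congr (_ * _); apply: eq_bigr => e _; rewrite ffunE invgK permE//.
Qed.

Lemma lik_le_sqrt s g : confusable s g ->
  lik g <= Num.sqrt (lik g * lik (relabel2 s^-1%g g)).
Proof.
move=> sg; rewrite -[leLHS]ger0_norm ?lik_ge0// -sqrtr_sqr ler_wsqrtr//.
by rewrite expr2 ler_wpM2l ?lik_ge0.
Qed.

Lemma prod_attr_weight s S z :
  \prod_(x : attr_edge n m) perm_weight (edge_perm m s)
     (fun e => tilted_kernel (edge_tilt S z e) (law e)) (inr x)
  <= expR (- psi q) ^+ (#|moved s| * m).
Proof.
rewrite -card_moved_attr_edges -prodr_const [leRHS]big_mkcond /=.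
apply: ler_prod => -[i a] _; rewrite /perm_weight permE /= inE /=.
rewrite [_ == _](_ : _ = (s i == i)); last first.
  by apply/eqP/eqP => [[]|->].
case: eqVneq => _ /=; first by rewrite tilted_trace// subrr mul0r addr0 ler01 lexx.
by rewrite kernel_norm_ge0 kernel_norm1_le.
Qed.

Lemma perm_weight_ge0 s S z e : 0 <= z ->
  0 <= perm_weight (edge_perm m s)
     (fun e => tilted_kernel (edge_tilt S z e) (law e)) e.
Proof.
move=> z0; rewrite /perm_weight; case: ifP => _; last exact: kernel_norm_ge0.
by apply: sumr_ge0 => a _; rewrite tilted_kernel_ge0// edge_tilt_ge0.
Qed.

(** Without tilting, all traces are 1 and only the moved edges contribute. *)
Lemma prod_user_weight1 s S : 0 <= psi p ->
  \prod_(u : user_edge n) perm_weight (edge_perm m s)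
     (fun e => tilted_kernel (edge_tilt S 1 e) (law e)) (inl u)
  <= expR (- psi p) ^+ (#|moved s| * (n - #|moved s|)).
Proof.
move=> psi0; apply: (@le_trans _ _ (expR (- psi p) ^+
    #|[set u | perm_edge s (inl u : edge n m) != inl u]|)); last first.
  apply: ler_wiXn2l; rewrite ?expR_ge0 ?card_moved_user_edges//.
  by rewrite -expR0 ler_expR oppr_le0.
rewrite -prodr_const [leRHS]big_mkcond /=.
apply: ler_prod => u _; rewrite perm_weight_ge0//= /perm_weight permE inE /= if_same.
case: ifP => _ /=; first by rewrite tilted_trace// subrr mul0r addr0.
by rewrite kernel_norm1_le.
Qed.

(** Moved edges weigh at most 1 by assumption. The only weights above 1 come from fixed edges that
    meet the moved users, at most one per moved user. *)
Lemma prod_user_weight s z : 1 <= z -> kernel_norm (tilted_kernel z p) <= 1 ->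
  \prod_(u : user_edge n) perm_weight (edge_perm m s)
     (fun e => tilted_kernel (edge_tilt (moved s) z e) (law e)) (inl u)
  <= expR ((z - 1) * p true true) ^+ #|moved s|.
Proof.
move=> z1 norm1; have p11 : 0 <= p true true by case: p_prob.
have E1 : 1 <= expR ((z - 1) * p true true).
  by rewrite -[leLHS]expR0 ler_expR mulr_ge0// subr_ge0.
apply: (@le_trans _ _ (expR ((z - 1) * p true true) ^+
  #|[set u | meets (moved s) u & perm_edge s (inl u : edge n m) == inl u]|)); last first.
  exact: ler_weXn2l (card_fixed_user_edges m s).
rewrite -prodr_const [leRHS]big_mkcond /=.
apply: ler_prod => u _; rewrite perm_weight_ge0 ?(le_trans ler01 z1)//=.
rewrite /perm_weight permE inE /=.
case: ifP => [_|/negbT/meets_moved ->]; last by rewrite andbF.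
rewrite andbT; case: ifP => _; rewrite tilted_trace//; first exact: expR_ge1Dx.
by rewrite subrr mul0r addr0.
Qed.

Lemma confusable_prob_small s : 0 <= psi p ->
  \sum_(g | confusable s g) lik g <=
  expR (- psi p) ^+ (#|moved s| * (n - #|moved s|)) *
  expR (- psi q) ^+ (#|moved s| * m).
Proof.
move=> psi0; apply: (@le_trans _ _ (\prod_e perm_weight (edge_perm m s)
            (fun e => tilted_kernel (edge_tilt finset.set0 1 e) (law e)) e)).
  apply: le_trans (sum_sqrt_lik s finset.set0 ler01).
  rewrite big_mkcond; apply: ler_sum => g _; rewrite expr1n mul1r.
  by case: ifP => [/lik_le_sqrt//|_]; rewrite sqrtr_ge0.
rewrite big_sumType /=; apply: ler_pM.
- by apply: prodr_ge0 => u _; exact: perm_weight_ge0.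
- by apply: prodr_ge0 => u _; exact: perm_weight_ge0.
- exact: prod_user_weight1.
- exact: prod_attr_weight.
Qed.

(** A Chernoff bound: on the event, the factor [expR (c * (joint_degree - T))] is at least 1, and it
    amounts to a tilt by [z = expR c]. *)
Lemma confusable_prob_large s (c T : R) : 0 <= c ->
  kernel_norm (tilted_kernel (expR c) p) <= 1 ->
  (expR c - 1) * p true true <= 1 ->
  \sum_(g | confusable s g && (T <= (joint_degree (moved s) g)%:R)) lik g <=
  expR (- (c * T)) * (expR 1 ^+ #|moved s| * expR (- psi q) ^+ (#|moved s| * m)).
Proof.
move=> c0 norm1 p11; have z1 : 1 <= expR c by rewrite -expR0 ler_expR.
have z0 := expR_ge0 c.
apply: (@le_trans _ _ (expR (- (c * T)) * \prod_e perm_weight (edge_perm m s)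
    (fun e => tilted_kernel (edge_tilt (moved s) (expR c) e) (law e)) e)).
  apply: le_trans (ler_wpM2l (expR_ge0 _) (sum_sqrt_lik s (moved s) z0)).
  rewrite mulr_sumr big_mkcond; apply: ler_sum => g _.
  rewrite mulrA -expRM_natl -expRD.
  case: ifP => [/andP[/lik_le_sqrt sg Tg]|_]; last by rewrite mulr_ge0 ?expR_ge0 ?sqrtr_ge0.
  apply: le_trans sg _; rewrite ler_peMl ?sqrtr_ge0// -[leLHS]expR0 ler_expR.
  by rewrite addrC mulrC -mulrBr mulr_ge0// subr_ge0.
rewrite ler_wpM2l ?expR_ge0// big_sumType /=; apply: ler_pM.
- by apply: prodr_ge0 => u _; exact: perm_weight_ge0.
- by apply: prodr_ge0 => u _; exact: perm_weight_ge0.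
- apply: le_trans (prod_user_weight s z1 norm1) _.
  by rewrite lerXn2r ?nnegrE ?expR_ge0// ler_expR.
- exact: prod_attr_weight.
Qed.

(** Chernoff's bound for the lower tail, with tilt [expR (- 1)]: since [expR (- 1) <= 1 / 2], each
    edge meeting [S] contributes at most [expR (- (p11 / 2))], and there are at least
    [#|S| * n.-1 / 2] such edges. *)
Lemma joint_degree_tail S (T : R) :
  \sum_(g | (joint_degree S g)%:R < T) lik g <=
  expR (T - p true true * (#|S| * n.-1)%:R / 4).
Proof.
have p11 : 0 <= p true true by case: p_prob.
have y0 : 0 <= expR (- 1 : R) by exact: expR_ge0.
apply: (@le_trans _ _ (expR T * \prod_e \sum_a \sum_b
    tilt (edge_tilt S (expR (- 1)) e) a b * law e a b)).
  rewrite -sum_graph_pairs mulr_sumr big_mkcond; apply: ler_sum => g _.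
  rewrite big_split /= prod_tilt -/(lik g) mulrA -expRM_natl -expRD.
  case: ifP => [Tg|_]; last by rewrite mulr_ge0 ?expR_ge0 ?lik_ge0.
  rewrite ler_peMl ?lik_ge0// -[leLHS]expR0 ler_expR mulrN1 subr_ge0; exact: ltW.
rewrite expRD ler_wpM2l ?expR_ge0// big_sumType /= [X in _ * X]big1 ?mulr1; last first.
  move=> x _; have /prob_vectorE[_ _ _ _ q1] := q_prob.
  by rewrite !big_bool /= /tilt /= !mul1r addrA.
apply: (@le_trans _ _ (expR (- (p true true / 2)) ^+ #|[set u | meets S u]|)).
  rewrite -prodr_const [leRHS]big_mkcond /=; apply: ler_prod => u _.
  apply/andP; split.
    apply: sumr_ge0 => a _; apply: sumr_ge0 => b _.
    by rewrite mulr_ge0 ?tilt_ge0 ?(edge_tilt_ge0 S (inl u) y0)//; case: p_prob.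
  rewrite inE !big_bool /= /tilt /= !mul1r.
  have /prob_vectorE[_ _ _ _ p1] := p_prob.
  case: (meets S u); last by lra.
  apply: le_trans (expR_ge1Dx _).
  have : expR (- 1 : R) <= 1 / 2.
    rewrite expRN div1r lef_pV2 ?posrE ?expR_gt0//.
    by have := expR_ge1Dx (1 : R); lra.
  move: (expR _) => y y2; have := ler_wpM2r p11 y2; lra.
rewrite -expRM_natl ler_expR.
have : ((#|S| * n.-1)%:R <= 2 * #|[set u | meets S u]|%:R :> R).
  by rewrite -natrM ler_nat card_meets.
move: (_ * _)%:R (#|[set u | _]|%:R) => x y xy; have := ler_wpM2l p11 xy; lra.
Qed.

End Likelihood.

(** * The union bound *)

Lemma ffact_le_exp n k : (n ^_ k <= n ^ k)%N.
Proof.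
elim: k n => [|k IH] n; first by rewrite ffactn0 expn0.
rewrite ffactnS expnS leq_mul2l; apply/orP; right.
by apply: leq_trans (IH _) _; case: k {IH} => // k; rewrite leq_exp2r ?leq_pred.
Qed.

Lemma moved_eq0 n (s : 'S_n) : (#|moved s| == 0)%N = (s == 1%g).
Proof.
rewrite cards_eq0; apply/eqP/eqP => [s0|->].
  apply/permP => i; rewrite perm1; apply/eqP; apply: contraFT (finset.in_set0 i).
  by rewrite -s0 inE.
by apply/setP => i; rewrite !inE perm1 eqxx.
Qed.

Section Counting.
Variables (R : realType) (n : nat).

(** There are ['C(n, k)] sets of size [k], each the moved set of at most [k!] permutations, and
    ['C(n, k) * k!] is at most [n ^ k]. *)
Lemma sum_moved_le (x : R) : 0 <= x ->
  \sum_(s : 'S_n | s != 1%g) x ^+ #|moved s| <=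
  \sum_(k < n.+1 | (0 < k)%N) (n%:R * x) ^+ k.
Proof.
move=> x0.
rewrite (partition_big (@moved n) (fun S : {set 'I_n} => (0 < #|S|)%N)) /=; last first.
  by move=> s; rewrite lt0n moved_eq0.
apply: (@le_trans _ _ (\sum_(S : {set 'I_n} | (0 < #|S|)%N) ((#|S|)`!)%:R * x ^+ #|S|)).
  apply: ler_sum => S _; rewrite (eq_bigr (fun=> x ^+ #|S|)); last first.
    by move=> s /andP[_ /eqP ->].
  rewrite sumr_const -[leLHS]mulr_natl ler_wpM2r ?exprn_ge0// ler_nat -card_perm.
  apply: subset_leq_card; apply/fintype.subsetP => s /andP[_ /eqP <-].
  by apply/fintype.subsetP => i; rewrite !inE.
rewrite (partition_big (fun S : {set 'I_n} => inord #|S| : 'I_n.+1)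
  (fun k => (0 < k)%N)) /=; last first.
  by move=> S S0; rewrite inordK// ltnS -[leqRHS]card_ord max_card.
apply: ler_sum => k k0.
rewrite (eq_bigl (fun S : {set 'I_n} => #|S| == k)); last first.
  move=> S; have Sn : (#|S| < n.+1)%N by rewrite ltnS -[leqRHS]card_ord max_card.
  apply/andP/eqP => [[_ /eqP <-]|Sk]; first by rewrite inordK.
  by rewrite Sk; split=> //; apply/eqP/val_inj; rewrite /= inordK.
rewrite (eq_bigr (fun=> (k`!)%:R * x ^+ k)) => [|S /eqP -> //].
rewrite sumr_const -cardsE card_draws card_ord -[leLHS]mulr_natl mulrA -natrM bin_ffact.
by rewrite exprMn -natrX ler_wpM2r ?exprn_ge0// ler_nat ffact_le_exp.
Qed.

Lemma geometric_le (y : R) : 0 <= y -> y <= 1 / 2 ->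
  \sum_(k < n.+1 | (0 < k)%N) y ^+ k <= 2 * y.
Proof.
move=> y0 y2; rewrite big_mkcond big_ord_recl /= add0r.
under eq_bigr do rewrite /= exprS.
rewrite -mulr_sumr mulrC ler_wpM2r//.
have := subrX1 y n; have : 0 <= y ^+ n by exact: exprn_ge0.
have : 0 <= \sum_(i < n) y ^+ i by apply: sumr_ge0 => i _; exact: exprn_ge0.
move: (\sum_(i < n) _) (y ^+ n) => s t; nra.
Qed.

End Counting.

(** * Error probability at fixed [n] *)

Section FiniteBound.
Variables (R : realType) (n m : nat) (p q : pair_law R).
Hypotheses (p_prob : prob_vector p) (q_prob : prob_vector q).
Variables (C : R) (est : estimator n m).
Hypotheses (n_gt1 : (1 < n)%N) (C0 : 0 <= C) (est_MAP : is_MAP p q est).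
Hypotheses (psi_ge0 : 0 <= psi p) (psi_le : psi p <= p true true).
Hypothesis psi_ge : n%:R * p true true - C <= n%:R * psi p.
Hypothesis norm_le1 : kernel_norm (tilted_kernel (expR 32) p) <= 1.
Hypothesis p11_small : (expR 32 - 1) * p true true <= 1.

(** The bound per moved user, common to both cases: small moved sets cost [C + 32] in the exponent,
    large ones 1, and [C + 33] covers either. *)
Let x := expR (C + 33 - n%:R * p true true - m%:R * psi q).
(** With tilt [expR 32], the factor 1/16 yields a gain of [2 * n * p11] per moved user. It also
    leaves the tail exponent at most [- #|S| * n * p11 / 16], which is below [- 2 * n] for large
    [S]. *)
Let threshold (S : {set 'I_n}) : R := #|S|%:R * (n%:R * p true true) / 16.
Let large (S : {set 'I_n}) := 32 < #|S|%:R * p true true.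

Lemma confusable_small_le (s : 'S_n) : ~~ large (moved s) ->
  \sum_(g : graph n m * graph n m | confusable p q s g) lik p q g <= x ^+ #|moved s|.
Proof.
rewrite -leNgt => small; apply: le_trans (confusable_prob_small m p_prob q_prob s psi_ge0) _.
have kn : (#|moved s| <= n)%N by rewrite -[leqRHS]card_ord max_card.
rewrite /x -!expRM_natl -expRD ler_expR.
rewrite !natrM natrB//.
move: small; move: (#|moved s|)%:R (ler0n R #|moved s|) => k k0 small.
rewrite (_ : _ + _ = k * (- (n%:R * psi p) + k * psi p - m%:R * psi q)); last by ring.
rewrite ler_wpM2l//.
by have := ler_wpM2l k0 psi_le; have := psi_ge; lra.
Qed.

Lemma confusable_large_le (s : 'S_n) :
  \sum_(g : graph n m * graph n m | confusable p q s g &&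
            (threshold (moved s) <= (joint_degree (moved s) g)%:R)) lik p q g
  <= x ^+ #|moved s|.
Proof.
apply: le_trans (confusable_prob_large m p_prob q_prob _ _ (ler0n R 32) norm_le1 p11_small) _.
rewrite /x -!expRM_natl -!expRD ler_expR /threshold natrM.
have k0 := ler0n R #|moved s|; move: (#|moved s|)%:R k0 => k k0.
rewrite (_ : _ + _ = k * (- (2 * (n%:R * p true true)) + 1 - m%:R * psi q)); last by field.
rewrite ler_wpM2l//.
have : 0 <= n%:R * p true true by rewrite mulr_ge0//; case: p_prob.
by have := C0; lra.
Qed.

Lemma tail_le (S : {set 'I_n}) : large S ->
  \sum_(g : graph n m * graph n m | (joint_degree S g)%:R < threshold S) lik p q g
  <= expR (- (2 * n%:R)).
Proof.
rewrite /large => S_large; apply: le_trans (joint_degree_tail m p_prob q_prob _ _) _.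
rewrite ler_expR /threshold natrM.
have n2 : (n%:R : R) <= 2 * n.-1%:R by rewrite -natrM ler_nat; lia.
have n0 : (0 : R) <= n%:R by [].
have kp0 := le_trans (ler0n R 32) (ltW S_large).
have := ler_wpM2l kp0 n2; have := ler_wpM2l n0 (ltW S_large).
lra.
Qed.

Lemma error_prob_bound : n%:R * x <= 1 / 2 ->
  error_prob p q est <= 2 * (n%:R * x) + expR (- n%:R).
Proof.
move=> nx; apply: le_trans (error_prob_le p_prob q_prob est_MAP) _.
(* A confusable [s] falls under [ev], or its moved set is [bad]. The latter depends on [s] only
   through that set, so it is summed over [2 ^ n] sets instead of over permutations. *)
pose ev (s : 'S_n) (g : graph n m * graph n m) := [&& s != 1%g, confusable p q s g &
  ~~ large (moved s) || (threshold (moved s) <= (joint_degree (moved s) g)%:R)].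
pose bad S (g : graph n m * graph n m) :=
  large S && ((joint_degree S g)%:R < threshold S).
apply: (@le_trans _ _ (\sum_(g : graph n m * graph n m)
   ((\sum_(s | ev s g) lik p q g) + (\sum_(S | bad S g) lik p q g)))).
  have L0 := @lik_ge0 _ n m _ _ p_prob q_prob.
  rewrite big_mkcond; apply: ler_sum => g _; case: ifP; last first.
    by move=> _; rewrite addr_ge0// sumr_ge0.
  case/existsP => s /andP[s1 sg].
  case: (boolP (ev s g)) => [sev|].
    by rewrite (bigD1 s)//= -addrA lerDl addr_ge0// sumr_ge0.
  rewrite /ev s1 sg /= negb_or negbK -ltNge => sbad.
  by rewrite addrC (bigD1 (moved s))//= -addrA lerDl addr_ge0// sumr_ge0.
rewrite big_split /=; apply: lerD.
  rewrite (exchange_big_dep (fun s => s != 1%g)) /=; last by move=> g s _ /and3P[].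
  apply: le_trans (geometric_le n (mulr_ge0 (ler0n _ n) (expR_ge0 _)) nx).
  apply: le_trans (sum_moved_le n (expR_ge0 _)).
  apply: ler_sum => s s1; rewrite /ev s1 /=.
  case: (boolP (large _)) => [_|sl] /=; first exact: confusable_large_le.
  by under eq_bigl do rewrite andbT; exact: confusable_small_le.
rewrite (exchange_big_dep large) /=; last by move=> g S _ /andP[].
apply: (@le_trans _ _ (\sum_(S : {set 'I_n}) expR (- (2 * n%:R)))).
  rewrite big_mkcond; apply: ler_sum => S _; case: ifP => [Sl|_]; last exact: expR_ge0.
  by rewrite /bad Sl; exact: tail_le.
rewrite sumr_const -cardsT -powersetT card_powerset cardsT card_ord.
rewrite -[leLHS]mulr_natl natrX.
(* The number [2 ^ n] of sets is at most [expR n], which costs half of the tail exponent. *)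
rewrite (_ : - n%:R = n%:R + - (2 * n%:R)); last by ring.
rewrite expRD ler_wpM2r ?expR_ge0//.
rewrite -[n%:R in leRHS]mulr1 expRM_natl lerXn2r ?nnegrE ?expR_ge0//.
by have := expR_ge1Dx (1 : R); lra.
Qed.

End FiniteBound.

(** * The sparse regime *)

(** The covariance of the two indicators is [r11 * r00 - r10 * r01]. *)
Lemma positively_correlated_lt (R : realType) (r : pair_law R) :
  prob_vector r -> positively_correlated r ->
  r true false * r false true < r true true * r false false.
Proof.
move=> /prob_vectorE[_ _ _ _ r1] [v1 v2].
rewrite /correlation pmulr_lgt0 ?invr_gt0 ?sqrtr_gt0 ?mulr_gt0//.
rewrite /pair_cov /pair_expect /coord1 /coord2 !big_bool /=.
have -> : r false false = 1 - r true true - r true false - r false true by rewrite -r1; ring.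
by rewrite !(mulr0, mulr1, addr0, add0r); nra.
Qed.

(** With [A] and [B] the two square roots, [0 <= B <= d * A] and [B <= A] place [(A - B) ^+ 2]
    between [A ^+ 2 * (1 - 2 * d)] and [A ^+ 2 = r11 * r00]. *)
Lemma psi_bounds (R : realType) (r : pair_law R) (d : R) : prob_vector r ->
  r true false * r false true < r true true * r false false ->
  0 <= d <= 1 ->
  Num.sqrt (r true false * r false true)
    <= d * Num.sqrt (r true true * r false false) ->
  r true true * (1 - (r true true + (r true false + r false true) + 2 * d))
    <= psi r <= r true true.
Proof.
move=> r_prob cov /andP[d0 d1] dP.
have /prob_vectorE[r11 r10 r01 r00 r1] := r_prob.
have B0 := sqrtr_ge0 (r true false * r false true).
have := sqr_sqrtr (mulr_ge0 r11 r00); have A0 := sqrtr_ge0 (r true true * r false false).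
have BA : Num.sqrt (r true false * r false true)
    <= Num.sqrt (r true true * r false false) by rewrite ler_wsqrtr// ltW.
rewrite /psi; move: (Num.sqrt _) (Num.sqrt _) A0 B0 BA dP => B A A0 B0 BA dP A2.
have p00 : r true true * r false false <= r true true by rewrite ler_piMr//; lra.
apply/andP; split; last by nra.
apply: (@le_trans _ _ (A ^+ 2 * (1 - 2 * d))).
  rewrite A2.
  have -> : r false false = 1 - r true true - r true false - r false true by rewrite -r1; ring.
  rewrite -mulrA ler_wpM2l//.
  have : 0 <= d * (r true true + r true false + r false true).
    by rewrite mulr_ge0// !addr_ge0.
  lra.
have : 0 <= A * (d * A - B) by rewrite mulr_ge0// subr_ge0.
have : 0 <= B ^+ 2 by exact: sqr_ge0.
lra.
Qed.

(** [L / 2] is at most [expR (L / 2)], the square root of [n]. *)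
Lemma sqr_ln_le (R : realType) (n : nat) : (0 < n)%N ->
  0 <= ln (n%:R : R) -> ln (n%:R : R) ^+ 2 <= 4 * n%:R.
Proof.
move=> n0 L0; set L := ln _.
have nE : (n%:R : R) = expR (L / 2) ^+ 2.
  by rewrite -expRM_natl mulrC divfK// lnK// posrE ltr0n.
have := expR_ge1Dx (L / 2); rewrite nE -/L.
rewrite -/L in L0; move: (expR _) => y; nra.
Qed.

(** The quantities [r11], [r10 + r01] and [d] are all [O(1 / L)]. Hence the relative loss [w] of
    [psi r] against [r11] is [O(1 / L)]; as [n * r11] is [O(L)], the absolute loss is [O(1)]. The
    same rates let any fixed tilt be absorbed once [L] is large. *)
Lemma sparse_regime (R : realType) (r : pair_law R) (n : nat) (c1 c2 c3 : R)
    (L := ln (n%:R : R)) (z := expR 32 : R) (D := Num.sqrt c3) :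
  prob_vector r -> (0 < n)%N ->
  r true false * r false true < r true true * r false false ->
  0 <= c1 -> 0 <= c2 -> 0 <= c3 -> 1 <= L ->
  r true true <= c1 * (L / n%:R) ->
  r true false + r false true <= c2 / L ->
  r true false * r false true / (r true true * r false false) <= c3 / L ^+ 3 ->
  (z ^+ 2 + 1) * (4 * c1 + c2) + 2 * (z + 1) * D <= L ->
  [/\ 0 <= psi r, psi r <= r true true,
      n%:R * r true true - c1 * (4 * c1 + c2 + 2 * D) <= n%:R * psi r,
      kernel_norm (tilted_kernel z r) <= 1 & (z - 1) * r true true <= 1].
Proof.
move=> r_prob n0 cov c10 c20 c30 L1 h1 h2 h3 hL.
have /prob_vectorE[r11 r10 r01 r00 r1] := r_prob.
have L0 : 0 < L by apply: lt_le_trans L1.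
have n0R : 0 < (n%:R : R) by rewrite ltr0n.
have z1 : 1 <= z by rewrite -expR0 ler_expR.
have D0 : 0 <= D by exact: sqrtr_ge0.
pose rho := r true false * r false true / (r true true * r false false).
have pos : 0 < r true true * r false false.
  by apply: le_lt_trans cov; exact: mulr_ge0.
have rho0 : 0 <= rho by rewrite divr_ge0 ?mulr_ge0.
have rho1 : rho <= 1 by rewrite ler_pdivrMr// mul1r ltW.
pose d := Num.sqrt rho.
have d0 : 0 <= d by exact: sqrtr_ge0.
have d1 : d <= 1 by rewrite -sqrtr1 ler_wsqrtr.
have dP : Num.sqrt (r true false * r false true)
    <= d * Num.sqrt (r true true * r false false).
  by rewrite -sqrtrM// divfK// gt_eqF.
(* The square of the left side is [rho * L ^+ 2], at most [rho * L ^+ 3] because [1 <= L]. *)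
have dL : d * L <= D.
  rewrite -ler_sqr ?nnegrE ?mulr_ge0 ?(ltW L0)// exprMn !sqr_sqrtr//.
  apply: (@le_trans _ _ (rho * L ^+ 3)); last by rewrite -ler_pdivlMr ?exprn_gt0.
  by rewrite ler_wpM2l// exprS ler_peMl ?sqr_ge0.
have p11L : r true true * L <= 4 * c1.
  apply: le_trans (ler_wpM2r (ltW L0) h1) _.
  rewrite -mulrA [leRHS]mulrC ler_wpM2l// -[L / _ * _]mulrAC -expr2 ler_pdivrMr//.
  by rewrite sqr_ln_le// ltW.
have poL : (r true false + r false true) * L <= c2 by rewrite -ler_pdivlMr.
have nr : n%:R * r true true <= c1 * L.
  by rewrite mulrC -ler_pdivlMr// -mulrA.
have d01 : 0 <= d <= 1 by rewrite d0.
have /andP[psi_ge psi_le] := psi_bounds r_prob cov d01 dP.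
have z0 : 0 <= z by apply: le_trans z1.
split.
- by rewrite sqr_ge0.
- exact: psi_le.
- have := ler_wpM2l (ltW n0R) psi_ge.
  set w := r true true + _ + 2 * d.
  have wL : w * L <= 4 * c1 + c2 + 2 * D by rewrite /w; lra.
  have w0 : 0 <= w by rewrite /w !addr_ge0// mulr_ge0.
  have := ler_wpM2r w0 nr; have := ler_wpM2l c10 wL.
  move: (psi r) => ps; nra.
- apply: (tilted_norm_le1 r_prob z0 dP) => //.
  rewrite -(ler_pM2r L0).
  (* This gives [r10] and [r01] the same coefficient, so that the bound on their sum applies. *)
  have z2 : 2 * z <= z ^+ 2 + 1 by have := sqr_ge0 (z - 1); lra.
  have := ler_wpM2r r01 z2.
  have Z0 : 0 <= z ^+ 2 + 1 by rewrite addr_ge0 ?sqr_ge0.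
  have := ler_wpM2l Z0 p11L; have := ler_wpM2l Z0 poL.
  have Z1 : 0 <= 2 * (z + 1) by rewrite mulr_ge0// addr_ge0.
  have := ler_wpM2l Z1 dL.
  nra.
- rewrite -(ler_pM2r L0) mul1r.
  have Z1 : 0 <= z - 1 by rewrite subr_ge0.
  rewrite -mulrA; apply: le_trans (ler_wpM2l Z1 p11L) _.
  have : (z - 1) * (4 * c1) <= (z ^+ 2 + 1) * (4 * c1).
    by rewrite ler_wpM2r ?mulr_ge0//; have := sqr_ge0 z; nra.
  have : 0 <= (z ^+ 2 + 1) * c2 by rewrite mulr_ge0// addr_ge0 ?sqr_ge0.
  have : 0 <= 2 * (z + 1) * D by rewrite !mulr_ge0// addr_ge0.
  lra.
Qed.

(** * Passage to the limit *)

Local Open Scope classical_set_scope.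

Lemma bigO_le (R : realType) (f e : nat -> R) : f =O_\oo e ->
  exists2 c : R, 0 <= c & \forall n \near \oo, f n <= c * `|e n|.
Proof.
move=> /eqO_exP[c c0 fe]; exists c; first exact: ltW.
by apply: filterS fe => n; apply: le_trans; exact: ler_norm.
Qed.

Lemma ln_natr_ge (R : realType) (B : R) : \forall n \near \oo, B <= ln (n%:R : R).
Proof.
near=> n; have nB : expR B <= n%:R :> R by near: n; exact: nbhs_infty_ger.
have n0 : 0 < n%:R :> R by apply: lt_le_trans nB; exact: expR_gt0.
by rewrite -ler_expR lnK.
Unshelve. all: by end_near. Qed.

Theorem theorem2 (R : realType) (m : nat -> nat) (p q : nat -> pair_law R)
  (est : forall n, estimator n (m n))
  (p_prob : forall n, prob_vector (p n))
  (q_prob : forall n, prob_vector (q n))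
  (corr_pos : forall n (e : edge n (m n)),
     positively_correlated (edge_law (p n) (q n) e))
  (est_MAP : forall n, is_MAP (p n) (q n) (est n))
  (p11_bigO : (fun n => p n true true) =O_\oo
     (fun n => ln (n%:R : R) / n%:R))
  (p10_p01_bigO : (fun n => p n true false + p n false true) =O_\oo
     (fun n => 1 / ln (n%:R : R)))
  (ratio_bigO :
     (fun n => (p n true false * p n false true)
               / (p n true true * p n false false)) =O_\oo
     (fun n => 1 / ln (n%:R : R) ^+ 3))
  (info_cvg : (fun n => n%:R * p n true true + (m n)%:R * psi (q n)
                        - ln (n%:R : R)) @ \oo --> +oo) :
  (fun n => error_prob (p n) (q n) (est n)) @ \oo --> (0 : R).
Proof.
have [c1 c10 h1] := bigO_le p11_bigO.
have [c2 c20 h2] := bigO_le p10_p01_bigO.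
have [c3 c30 h3] := bigO_le ratio_bigO.
pose z := expR 32 : R; pose D := Num.sqrt c3.
pose C := c1 * (4 * c1 + c2 + 2 * D).
have C0 : 0 <= C by rewrite mulr_ge0// !addr_ge0 ?mulr_ge0 ?sqrtr_ge0.
apply/cvgrPdist_le => e e0.
(* [1 / 2] is what the geometric series requires; [e / 4] makes its bound [2 * (n * x)] at most
   [e / 2], the other half being left for [expR (- n)]. *)
pose t := Num.min (1 / 2) (e / 4).
have t0 : 0 < t by rewrite lt_min !divr_gt0.
near=> n.
have L1 : 1 <= ln (n%:R : R) by near: n; exact: ln_natr_ge.
have LK : (z ^+ 2 + 1) * (4 * c1 + c2) + 2 * (z + 1) * D <= ln (n%:R : R).
  by near: n; exact: ln_natr_ge.
have Le : - ln (e / 2) <= ln (n%:R : R) by near: n; exact: ln_natr_ge.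
have n_gt1 : (1 < n)%N by near: n; exact: nbhs_infty_gt.
have n0 : (0 < n)%N by exact: ltn_trans n_gt1.
have n0R : 0 < (n%:R : R) by rewrite ltr0n.
have L0 : 0 < ln (n%:R : R) by apply: lt_le_trans L1.
have H1 : p n true true <= c1 * (ln (n%:R : R) / n%:R).
  rewrite -[ln _ / _]ger0_norm; first by near: n; exact: h1.
  by rewrite divr_ge0// ltW.
have H2 : p n true false + p n false true <= c2 / ln (n%:R : R).
  rewrite -[_^-1]div1r -[1 / _]ger0_norm; first by near: n; exact: h2.
  by rewrite divr_ge0// ltW.
have H3 : p n true false * p n false true / (p n true true * p n false false)
    <= c3 / ln (n%:R : R) ^+ 3.
  rewrite -[(_ ^+ 3)^-1]div1r -[1 / _]ger0_norm; first by near: n; exact: h3.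
  by rewrite divr_ge0// exprn_ge0// ltW.
have cov : p n true false * p n false true < p n true true * p n false false.
  (* Correlation is assumed edge by edge, so an actual user edge is exhibited, which takes two
     users. *)
  have nb : #|[set Ordinal n0; Ordinal n_gt1]%SET| == 2%N by rewrite cards2.
  apply: positively_correlated_lt => //.
  exact: (corr_pos n (inl (exist _ [set Ordinal n0; Ordinal n_gt1]%SET nb))).
have [psi0 psi_le psi_ge norm1 p11_small] :=
  sparse_regime (p_prob n) n0 cov c10 c20 c30 L1 H1 H2 H3 LK.
have info : C + 33 - ln t <= n%:R * p n true true + (m n)%:R * psi (q n) - ln (n%:R : R).
  by near: n; move/cvgryPge : info_cvg; exact.
pose x := expR (C + 33 - n%:R * p n true true - (m n)%:R * psi (q n)).
have nx : n%:R * x <= t.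
  rewrite /x -[n%:R in X in X * _]lnK ?posrE// -expRD -[t]lnK ?posrE// ler_expR.
  lra.
have err0 : 0 <= error_prob (p n) (q n) (est n).
  apply: sumr_ge0 => w _; rewrite mulr_ge0 ?invr_ge0//.
  exact: (lik_ge0 (p_prob n) (q_prob n) w.1).
rewrite sub0r normrN ger0_norm//.
have nx2 : n%:R * x <= 1 / 2 by apply: le_trans nx _; rewrite ge_min lexx.
apply: le_trans (error_prob_bound (p_prob n) (q_prob n) n_gt1 C0 (est_MAP n)
  psi0 psi_le psi_ge norm1 p11_small nx2) _.
have nx4 : n%:R * x <= e / 4 by apply: le_trans nx _; rewrite ge_min lexx orbT.
have : expR (- n%:R) <= e / 2.
  rewrite -[e / 2]lnK ?posrE ?divr_gt0// ler_expR lerNl; apply: le_trans Le _.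
  by have := expR_ge1Dx (ln (n%:R : R)); rewrite lnK ?posrE//; lra.
rewrite -/x; lra.
Unshelve. all: by end_near. Qed.
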